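(* Let $(X,\tau)$ be a Hausdorff space, let $p,k,m\in\omega$ and suppose that $Sel^c_{\leq k}(X)\neq\emptyset$. If $p\leq k$, $\frac{m}{2}\leq k$ and $p$ divides $m$, then $Sel^c_m(X)\neq\emptyset$.
   Context: $\omega$ is the set of natural numbers. For a Hausdorff space $(X,\tau)$, $\mathcal{F}(X)$ is the set of nonempty closed subsets of $X$, with the Vietoris topology: the topology generated by the sets $\langle\mathcal{V}\rangle=\{A\in\mathcal{F}(X) : A\subseteq\bigcup\mathcal{V}\text{ and } A\cap V\neq\emptyset\text{ for all }V\in\mathcal{V}\}$, where $\mathcal{V}$ is a finite subset of $\tau$. $[X]^n$ is the set of all subsets of $X$ of cardinality $n$, and $F_n(X)=\{A\in\mathcal{F}(X): |A|\leq n\}$. For $\mathfrak{F}\subseteq\mathcal{F}(X)$, a selection is a function $f:\mathfrak{F}\to X$ with $f(A)\in A$ for all $A\in\mathfrak{F}$; it is a continuous selection if it is also continuous with respect to the Vietoris topology restricted to $\mathfrak{F}$. $Sel^c_n(X)$ is the set of continuous selections $f:[X]^n\to X$, and $Sel^c_{\leq n}(X)$ is the set of continuous selections $f:F_n(X)\to X$.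
   Formalization: The hypothesis p ≠ 1 is added: for p = 1 the claim fails (X the circle, p = k = 1, m = 2), since the circle has no continuous selection on pairs; p is presumably meant to be prime. *)

(* Defs.v *)
From HB Require Import structures.
From mathcomp Require Import all_boot all_order all_algebra.
From mathcomp Require Import all_classical topology.

Set Implicit Arguments.
Unset Strict Implicit.
Unset Printing Implicit Defensive.

Local Open Scope classical_set_scope.
Local Open Scope card_scope.

(* No separation axiom is built in: Hausdorffness of [X] is a hypothesis
   wherever it is needed. *)
Definition hyperspace (X : topologicalType) : Type :=
  set_type [set A : set X | closed A /\ A !=set0].

Definition hset (X : topologicalType) (A : hyperspace X) : set X := \val A.

Definition vietoris_open (X : topologicalType) (V : set (set X)) :
    set (hyperspace X) :=
  [set A : hyperspace X | hset A `<=` \bigcup_(U in V) U /\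
     forall U, V U -> hset A `&` U !=set0].

Definition vietoris_index (X : topologicalType) : set (set (set X)) :=
  [set V | finite_set V /\ forall U, V U -> open U].

HB.instance Definition _ (X : topologicalType) :=
  Choice.copy (hyperspace X) (set_type [set A : set X | closed A /\ A !=set0]).
HB.instance Definition _ (X : topologicalType) :=
  @isSubBaseTopological.Build (hyperspace X) (set (set X))
    (@vietoris_index X) (@vietoris_open X).

(* As a subfamily of the hyperspace, [subsets_of_card X 0] is empty: the empty
   set is not a point of [hyperspace X].  For [0 < n] and [X] Hausdorff, every
   [n]-element subset of [X] is closed, hence belongs to the family. *)
Definition subsets_of_card (X : topologicalType) (n : nat) :
    set (hyperspace X) := [set A : hyperspace X | hset A #= `I_n].

Definition subsets_of_card_le (X : topologicalType) (n : nat) :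
    set (hyperspace X) := [set A : hyperspace X | hset A #<= `I_n].

Arguments subsets_of_card : clear implicits.
Arguments subsets_of_card_le : clear implicits.

Definition is_selection (X : topologicalType) (F : set (hyperspace X))
    (f : F -> X) : Prop :=
  forall A : F, hset (\val A) (f A).

(* [F], coerced to a type, carries the topology induced by the Vietoris
   topology of [hyperspace X]. *)
Definition continuous_selections (X : topologicalType)
    (F : set (hyperspace X)) : set (F -> X) :=
  [set f : F -> X | is_selection f /\ continuous f].

Arguments continuous_selections : clear implicits.

Definition Selc (X : topologicalType) (n : nat) :=
  continuous_selections X (subsets_of_card X n).

Definition Selc_le (X : topologicalType) (n : nat) :=
  continuous_selections X (subsets_of_card_le X n).

Arguments Selc : clear implicits.
Arguments Selc_le : clear implicits.

(* Main.v *)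
Require Import Defs.
From mathcomp Require Import all_boot all_order all_algebra.
From mathcomp Require Import finmap.
From mathcomp Require Import all_classical topology.

(** Since [p <> 1] divides [m], a prime divisor [q] of [p] also divides [m],
    and [q <= p <= k]; so [p] may be assumed prime when [m > 0] (for [m = 0]
    the family has no member at all).

    Let [f] be a continuous selection on the sets with at most [k] points and
    let [A] have [n] points, where [0 < n <= 2k] and the prime [q <= k] divides
    [n].  Every [q]-point subset [B] of [A] casts one vote for the point [f B].
    There are ['C(n, q)] votes, and [n] does not divide this number
    ([card_dvdN_bin_prime]), so the [n] points of [A] cannot all receive the
    same number of votes.  Hence the points with the most votes form a nonempty
    proper subset of [A]; either it or its complement has at most [n/2 <= k]
    points, and [f] may be applied to that part, the minority.  Its value there
    is the point selected from [A].

    The outcome only depends on the finite pattern telling, for each small set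
    of indices [I], which of the points [x i] is chosen by [f] from
    [x @` I], where [x] is an enumeration of [A].  The construction commutes
    with renumbering ([winner_equivariant]), so the choice of [x] is immaterial;
    and the pattern is locally constant in [x] ([near_chosen_index]), because
    [f] is continuous and distinct points of [X] can be separated.  A set which
    is Vietoris-close to [A] and has as many points as [A] has an enumeration
    close to [x], so the selection is continuous. *)

Set Implicit Arguments.
Unset Strict Implicit.
Unset Printing Implicit Defensive.

Import GRing.Theory Num.Theory.

(** * Voting on a finite set *)

(** The identity [p * 'C(n, p) = n * 'C(n - 1, p - 1)] would make [p] divide
    ['C(n - 1, p - 1)], hence the product [(n - 1) ... (n - p + 1)]; but
    [p %| n], so none of these factors is a multiple of [p]. *)
Lemma card_dvdN_bin_prime n p :
  prime p -> 0 < n -> p %| n -> ~~ (n %| 'C(n, p)).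
Proof.
move=> p_pr n_gt0 pn; have p_gt0 := prime_gt0 p_pr.
apply/negP => /dvdnP [c Ec].
have p_dvd : p %| 'C(n.-1, p.-1).
  apply/dvdnP; exists c; apply/eqP; rewrite -(eqn_pmul2l n_gt0) mul_bin_diag.
  by rewrite prednK // Ec [p * _]mulnC -mulnA mulnCA.
have : p %| n.-1 ^_ p.-1 by rewrite -bin_ffact dvdn_mulr.
rewrite ffact_prod Euclid_dvd_prod // big_has => /hasP [i _].
have i_lt : i.+1 < p by rewrite -ltn_predRL ltn_ord.
have le_in : i.+1 <= n := leq_trans (ltnW i_lt) (dvdn_leq n_gt0 pn).
rewrite -[_ - _]/(n.-1 - i) -subn1 -subnDA add1n dvdn_subr // => pi.
by move: (dvdn_leq (ltn0Sn i) pi); rewrite leqNgt i_lt.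
Qed.

Section Votes.
Variable T : finType.
Implicit Types (c : T -> nat) (sel : {set T} -> T) (h : T -> T).

Definition votes p sel t :=
  #|[set B : {set T} | (#|B| == p) && (sel B == t)]|.

Lemma sum_votes p sel : \sum_t votes p sel t = 'C(#|T|, p).
Proof.
rewrite -card_draws -sum1dep_card (partition_big sel predT) //=.
by apply: eq_bigr => t _; rewrite sum1dep_card.
Qed.

Lemma votes_nonconstant p sel : prime p -> 0 < #|T| -> p %| #|T| ->
  exists s t, votes p sel s != votes p sel t.
Proof.
move=> p_pr T_gt0 pT; have /card_gt0P [t0 _] := T_gt0.
case: (pickP [pred t | votes p sel t != votes p sel t0]) => [t ne|eq_v].
  by exists t, t0.
case/negP: (card_dvdN_bin_prime p_pr T_gt0 pT); rewrite -(sum_votes p sel).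
rewrite (eq_bigr (fun=> votes p sel t0)) ?sum_nat_const ?dvdn_mulr // => t _.
by apply/eqP; have /= /negbFE := eq_v t.
Qed.

Definition top c := [set t | c t == \max_s c s].

Definition minority c := if #|top c|.*2 <= #|T| then top c else ~: top c.

Lemma minority_gt0 c s t : c s != c t -> 0 < #|minority c|.
Proof.
move=> ne; rewrite /minority; case: ifP => _.
  have := @bigmax_eq_arg _ s predT c isT; case: arg_maxnP => //= u _ _ Eu.
  by apply/card_gt0P; exists u; rewrite inE Eu.
apply/card_gt0P; case: (eqVneq (c s) (\max_u c u)) => [Es|nEs].
  by exists t; rewrite !inE -Es eq_sym.
by exists s; rewrite !inE.
Qed.

Lemma minority_le c : #|minority c|.*2 <= #|T|.
Proof.
rewrite /minority; case: ifPn => //; rewrite -ltnNge => big.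
move: big; rewrite -(cardsC (top c)) -!addnn ltn_add2l leq_add2r.
exact: ltnW.
Qed.

Lemma minority_equivariant c c' h : injective h ->
  (forall t, c' (h t) = c t) -> minority c' = h @: minority c.
Proof.
move=> h_inj ch; have [g hK gK] := injF_bij h_inj.
have Emax : \max_s c' s = \max_s c s.
  by rewrite (reindex_inj h_inj); apply: eq_bigr.
have Etop : top c' = h @: top c.
  by apply/setP => t'; rewrite -(gK t') mem_imset // !inE ch Emax.
rewrite /minority Etop card_imset //; case: ifP => // _.
apply/setP => t'; rewrite -(gK t') finset.in_setC !mem_imset //.
by rewrite finset.in_setC.
Qed.

Lemma votes_equivariant p sel sel' h : injective h ->
  (forall B : {set T}, #|B| = p -> sel' (h @: B) = h (sel B)) ->
  forall t, votes p sel' (h t) = votes p sel t.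
Proof.
move=> h_inj sel_h t; rewrite /votes -[RHS](card_imset _ (imset_inj h_inj)).
apply: eq_card => B'; have [g hK gK] := injF_bij h_inj.
have -> : B' = h @: (g @: B').
  by rewrite -imset_comp (eq_imset _ gK) imset_id.
move: (g @: B') => B.
rewrite (mem_imset _ _ (imset_inj h_inj)) !inE card_imset //.
by case: eqP => //= cB; rewrite sel_h // (inj_eq h_inj).
Qed.

Definition winner p sel := sel (minority (votes p sel)).

(** The two choice rules need only correspond on the sets of at most [k]
    points: [p <= k] covers the voters, and [#|T| <= k.*2] the minority. *)
Lemma winner_equivariant p k sel sel' h : injective h ->
    prime p -> 0 < #|T| -> p %| #|T| -> p <= k -> #|T| <= k.*2 ->
    (forall B : {set T}, 0 < #|B| <= k -> sel' (h @: B) = h (sel B)) ->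
  winner p sel' = h (winner p sel).
Proof.
move=> h_inj p_pr T_gt0 pT le_pk le_Tk sel_h.
have votes_h : forall t, votes p sel' (h t) = votes p sel t.
  by apply: votes_equivariant => // B cB; apply: sel_h; rewrite cB prime_gt0.
rewrite /winner (minority_equivariant h_inj votes_h); apply: sel_h.
have [s [t /minority_gt0 ->]] := votes_nonconstant sel p_pr T_gt0 pT.
by rewrite -leq_double (leq_trans (minority_le _)).
Qed.

End Votes.

Local Open Scope classical_set_scope.
Local Open Scope card_scope.

(** * Neighbourhoods of a finite family of points *)

Section BoxNeighbourhoods.
Variables (X : topologicalType) (T : finType).
Implicit Types x y : T -> X.

(** As [T] is finite, these are the neighbourhoods of [x] in the product
    topology.  Keeping the boxes explicit gives one neighbourhood of each point
    [x t], and these form a Vietoris neighbourhood of the range of [x]. *)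
Definition box_nbhs x : set_system (T -> X) :=
  filter_from [set W : T -> set X | forall t, nbhs (x t) (W t)]
              (fun W => [set y | forall t, W t (y t)]).

#[global] Instance box_nbhs_filter x : Filter (box_nbhs x).
Proof.
apply: filter_from_filter => [|V W nV nW].
  by exists (fun=> setT) => t; exact: filterT.
exists (fun t => V t `&` W t) => [t|y VWy]; first exact: filterI.
by split=> t; have [] := VWy t.
Qed.

Lemma cvg_eval_box t x : y t @[y --> box_nbhs x] --> x t.
Proof.
move=> U nU; exists (fun s => if s == t then U else setT) => [s|y] /=.
  by case: eqP => [->//|_]; exact: filterT.
by move/(_ t); rewrite eqxx.
Qed.

End BoxNeighbourhoods.

Lemma cvg_neq {S : Type} {X : topologicalType} (F : set_system S)
    (u v : S -> X) (a b : X) :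
    Filter F -> hausdorff_space X -> a != b ->
    u @ F --> a -> v @ F --> b ->
  \forall s \near F, u s != v s.
Proof.
move=> FF; rewrite open_hausdorff => /[apply].
move=> [[U V] /= [/set_mem Ua /set_mem Vb] [Uo Vo /eqP UV]] ua vb.
have nU : \forall s \near F, U (u s) by apply: ua; exact: open_nbhs_nbhs.
have nV : \forall s \near F, V (v s) by apply: vb; exact: open_nbhs_nbhs.
near=> s; apply/eqP => uv; suff: (U `&` V) (u s) by rewrite UV.
by split; [near: s|rewrite uv; near: s].
Unshelve. all: by end_near. Qed.

Lemma near_box_inj (X : topologicalType) (T : finType) (x : T -> X) :
  hausdorff_space X -> injective x -> \forall y \near box_nbhs x, injective y.
Proof.
move=> hX x_inj.
have sep : \forall y \near box_nbhs x, forall st : T * T,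
    st.1 != st.2 -> y st.1 != y st.2.
  apply: filter_forall => -[s t] /=; case: (eqVneq s t) => [->|ne_st] /=.
    exact: filterS filterT.
  apply: filterS (_ : \forall y \near box_nbhs x, y s != y t) => //.
  apply: cvg_neq; [exact: hX|..|exact: cvg_eval_box|exact: cvg_eval_box].
  by rewrite (inj_eq x_inj).
apply: filterS sep => y sep s t /eqP; apply: contraTeq => ne_st.
exact: (sep (s, t)).
Qed.

(** * The Vietoris topology on finite sets *)

Section Vietoris.
Variable X : topologicalType.

Lemma open_vietoris_open (V : set (set X)) : vietoris_index V ->
  open (vietoris_open V).
Proof.
move=> hV; exists [set vietoris_open V]; last by rewrite bigcup_set1.
move=> _ ->; exists [fset V]%fset; last by rewrite set_fset1 bigcap_set1.
by move=> U /fset1P ->; exact: mem_set.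
Qed.

(** A subbasic Vietoris set given by a finite family [V] contains
    [y @` I] as soon as every [y t] lies in all the members of [V] that contain
    [x t]; as [T] and [V] are finite, this holds for all [y] near [x]. *)
Lemma cvg_hset_image (T : finType) (I : {set T})
    (e : (T -> X) -> hyperspace X) x :
    (forall y, hset (e y) = y @` [set` I]) ->
  e @ box_nbhs x --> e x.
Proof.
move=> eE N [B [[C CB <-] [D CD De] sBN]].
have /CB [/= V_ V_idx VD] := CD.
apply: filterS (_ : box_nbhs x (e @^-1` D)) => [y Dy|].
  by apply: sBN; exists D.
rewrite -VD.
apply: filterS (_ : \forall y \near box_nbhs x,
    forall V : V_, vietoris_open (val V) (e y)) => [y Vy V V_V|].
  exact: (Vy [` V_V]%fset).
apply: filter_forall => -[V /= V_V].
have /set_mem [V_fin V_open] := V_idx _ V_V.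
have [] : vietoris_open V (e x) by move: De; rewrite -VD; apply.
rewrite eE => sxV meetV.
have preserved : \forall y \near box_nbhs x,
    forall t (U : fset_set V), val U (x t) -> val U (y t).
  apply: filter_forall => t; apply: filter_forall => -[U /= U_V].
  case: (pselect (U (x t))) => [Ux|nUx]; last exact: filterS filterT.
  apply: filterS (_ : \forall y \near box_nbhs x, U (y t)) => //.
  apply: cvg_eval_box; apply: open_nbhs_nbhs; split=> //; apply: V_open.
  by move: U_V; rewrite in_fset_set // => /set_mem.
apply: filterS preserved => y pres.
have {}pres t U : V U -> U (x t) -> U (y t).
  move=> VU; have U_V : U \in fset_set V.
    by rewrite in_fset_set //; exact: mem_set.
  exact: (pres t [` U_V]%fset).
split; rewrite eE.
  move=> _ [t It <-]; have [|U VU Ux] := sxV (x t); first by exists t.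
  by exists U => //; exact: pres.
move=> U VU; have [_ [[t It <-] Ux]] := meetV U VU.
by exists (y t); split; [exists t|exact: pres].
Qed.

Lemma cvg_family (F : set (hyperspace X)) S (G : set_system S) (e : S -> F)
    (A : F) :
  Filter G ->
  (fun s => \val (e s)) @ G --> \val A -> e @ G --> A.
Proof.
move=> FG cv N [B [[C Co <-] CA sBN]].
apply: filterS (_ : \forall s \near G, C (\val (e s))) => [s|].
  exact: sBN.
by apply: cv; apply: open_nbhs_nbhs.
Qed.

End Vietoris.

Lemma exists_hset_image (X : topologicalType) (T : finType) (y : T -> X)
    (I : {set T}) k :
    hausdorff_space X -> 0 < #|I| <= k ->
  exists A : subsets_of_card_le X k, hset (\val A) = y @` [set` I].
Proof.
move=> hX /andP[I_gt0 le_Ik].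
have fin_I : finite_set (y @` [set` I]).
  by apply: finite_image; exact: finite_finset.
have cl_I : closed (y @` [set` I]).
  by move/hausdorff_accessible/accessible_finite_set_closed: hX; apply.
have /card_gt0P [t0 It0] := I_gt0.
have ne_I : y @` [set` I] !=set0 by exists (y t0); exists t0.
have mem_I : [set A : set X | closed A /\ A !=set0] (y @` [set` I]) by [].
have card_I : subsets_of_card_le X k (SigSub (mem_set mem_I)).
  rewrite /subsets_of_card_le /hset /=.
  apply: card_le_trans (card_image_le _ _) _.
  apply: card_le_trans (card_image_le (nth t0 (enum I)) `I_k).
  apply: subset_card_le => t It; exists (index t (enum I)).
    by rewrite /= (leq_trans _ le_Ik) // cardE index_mem mem_enum.
  by rewrite nth_index // mem_enum.
by exists (SigSub (mem_set card_I)).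
Qed.

Lemma exists_enumeration (X : choiceType) (B : set X) n : B #= `I_n ->
  exists2 x : 'I_n -> X, injective x & B = range x.
Proof.
rewrite card_eq_sym => /card_eqP [g].
have lt_n (i : 'I_n) : `I_n i by exact: ltn_ord.
exists (fun i => \val (g (SigSub (mem_set (lt_n i))))).
  move=> i j /val_inj /(inj (in_setT _) (in_setT _)) E; apply: val_inj.
  by have := congr1 \val E.
apply/seteqP; split=> [b Bb|_ [i _ <-]]; last exact: (set_mem (valP (g _))).
have [i _ gi] := @surj _ _ _ _ g (SigSub (mem_set Bb)) I.
exists (Ordinal (set_mem (valP i))) => //.
by rewrite (_ : SigSub _ = i) ?gi //; exact: val_inj.
Qed.

(** * The choice pattern of a selection *)

Section ChosenIndex.
Variables (X : topologicalType) (T : finType) (k : nat) (t0 : T).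
Variable f : subsets_of_card_le X k -> X.
Hypotheses (hX : hausdorff_space X) (f_sel : is_selection f).

(** Passing from points to indices turns the selection into combinatorial data,
    comparable between different families [y].  When [f] is a selection and [X]
    is Hausdorff, the default [t0] is only reached if [I] is empty or has more
    than [k] elements. *)
Definition chosen_index (y : T -> X) (I : {set T}) : T :=
  xget t0 [set t | exists2 A, hset (\val A) = y @` [set` I] & f A = y t].

Lemma chosen_indexE y (I : {set T}) (A : subsets_of_card_le X k) :
  hset (\val A) = y @` [set` I] -> y (chosen_index y I) = f A.
Proof.
move=> AE; rewrite /chosen_index.
set P := (P in xget _ P); have : P (xget t0 P).
  apply: xgetPex; have := f_sel A; rewrite AE => -[t It ft].
  by exists t; exists A.
case=> A' A'E <-; congr f; apply/val_inj/val_inj.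
by rewrite -[LHS]/(hset (\val A')) A'E -AE.
Qed.

Lemma chosen_index_comp x y (h : T -> T) (I : {set T}) : injective x ->
    (forall t, y t = x (h t)) -> 0 < #|I| <= k ->
  chosen_index x (h @: I) = h (chosen_index y I).
Proof.
move=> x_inj yE cI; have [A AE] := exists_hset_image y hX cI.
apply: x_inj; rewrite -yE (chosen_indexE AE); apply: chosen_indexE.
rewrite AE; apply/seteqP; split=> _ [t It <-].
  by exists (h t) => //; exact: imset_f.
by move: It; rewrite /= => /imsetP [s Is ->]; exists s.
Qed.

(** The value of [f] at [y @` I] tends to its value at [x @` I], which differs
    from every [x t] except the chosen one; so for [y] near [x] it differs from
    every other [y t], and only the same index remains possible. *)
Lemma near_chosen_index x (I : {set T}) :
    continuous f -> injective x -> 0 < #|I| <= k ->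
  \forall y \near box_nbhs x, chosen_index y I = chosen_index x I.
Proof.
move=> f_cont x_inj cI.
have [e eE] := choice (fun y => exists_hset_image y hX cI).
have cvg_fe : f (e y) @[y --> box_nbhs x] --> f (e x).
  apply: (@cvg_comp _ _ _ e f _ (nbhs (e x))); last exact: f_cont.
  apply: cvg_family.
  by apply: cvg_hset_image => y; exact: eE.
have avoid : \forall y \near box_nbhs x, forall t,
    t != chosen_index x I -> y t != f (e y).
  apply: filter_forall => t; case: eqVneq => [_|ne_t].
    exact: filterS filterT.
  apply: filterS (_ : \forall y \near box_nbhs x, y t != f (e y)) => //.
  apply: cvg_neq; [exact: hX| |exact: cvg_eval_box|exact: cvg_fe].
  by rewrite -(chosen_indexE (eE x)) (inj_eq x_inj).
apply: filterS avoid => y /(_ (chosen_index y I)) avoid; apply/eqP.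
by apply: contraT => /avoid; rewrite (chosen_indexE (eE y)) eqxx.
Qed.

End ChosenIndex.

(** * Selections for sets of a fixed size *)

(** The selected point is the winner of the vote on [A].  Any [q]-vote on an
    [m.+1]-point set is uneven since the prime [q] divides [m.+1], and the
    resulting minority is small enough for [f] since [m.+1 <= k.*2]. *)
Lemma Selc_nonempty_of_prime_dvd (X : topologicalType) (q k m : nat) :
    hausdorff_space X -> Selc_le X k !=set0 ->
    prime q -> q <= k -> m.+1 <= k.*2 -> q %| m.+1 ->
  Selc X m.+1 !=set0.
Proof.
move=> hX [f [f_sel f_cont]] q_pr le_qk le_mk q_dvd.
have enumP (A : subsets_of_card X m.+1) : exists2 x : 'I_m.+1 -> X,
    injective x & hset (\val A) = range x.
  by apply: exists_enumeration; exact: (set_mem (valP A)).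
(* Enumerations are picked set by set, with no continuity; equivariance makes
   up for it at the end. *)
have [x x_inj xE] : exists2 x : subsets_of_card X m.+1 -> 'I_m.+1 -> X,
    forall A, injective (x A) & forall A, hset (\val A) = range (x A).
  have [x xP] :=
    choice (fun A => iffLR (exists2P _ _) (enumP A)).
  by exists x => A; have [] := xP A.
pose sel (y : 'I_m.+1 -> X) := chosen_index ord0 f y.
pose w (y : 'I_m.+1 -> X) := winner q (sel y).
exists (fun A => x A (w (x A))); split=> [A|A U nU] /=.
  by rewrite xE; exists (w (x A)).
have [W nW W_good] : \forall y \near box_nbhs (x A),
    [/\ injective y, U (y (w (x A))) &
      forall I : {set 'I_m.+1}, 0 < #|I| <= k -> sel y I = sel (x A) I].
  near=> y; split; [near: y..|].
  - exact: near_box_inj.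
  - exact: cvg_eval_box nU.
  - near: y; apply: filter_forall => I.
    case: (boolP (0 < #|I| <= k)) => cI.
      apply: filterS (near_chosen_index ord0 hX f_sel f_cont (x_inj A) cI).
      by move=> z E _.
    exact: filterS filterT.
pose V := range (fun i => (W i)°).
have V_idx : vietoris_index V.
  split; first exact: finite_image.
  by move=> _ [i _ <-]; exact: open_interior.
have V_A : vietoris_open V (\val A).
  split; rewrite xE.
    move=> _ [i _ <-]; exists (W i)°; first by exists i.
    exact: nW.
  by move=> _ [i _ <-]; exists (x A i); split; [exists i|exact: nW].
have : nbhs A [set B : subsets_of_card X m.+1 | vietoris_open V (\val B)].
  apply: (@initial_continuous _ _ (@set_val _ (subsets_of_card X m.+1)) A).
  by apply: open_nbhs_nbhs; split=> //; exact: open_vietoris_open.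
apply: filterS => B [_ meetB].
(* A set [B] of the same size meeting every [W i] is enumerated, through [y],
   inside the box [W], hence also by [x B] up to the renumbering [h]. *)
have /choice [y y_B] : forall i, exists a, hset (\val B) a /\ W i a.
  move=> i; have [|a [Ba /interior_subset Wa]] := meetB (W i)°.
    by exists i.
  by exists a.
have [y_inj Uy sel_y] := W_good y (fun i => (y_B i).2).
have /choice [h hE] : forall i, exists j, y i = x B j.
  by move=> i; have [+ _] := y_B i; rewrite xE => -[j _ <-]; exists j.
have h_inj : injective h.
  by move=> i j hij; apply: y_inj; rewrite !hE hij.
suff E : w (x B) = h (w (x A)) by rewrite /preimage /= E -hE.
apply: (winner_equivariant h_inj q_pr _ _ le_qk) => [|||I cI].
1-3: by rewrite ?card_ord.
rewrite -sel_y //.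
exact: chosen_index_comp.
Unshelve. all: by end_near. Qed.

Local Open Scope ring_scope.

Theorem theorem4 (X : topologicalType) (p k m : nat)
    (hX : hausdorff_space X)
    (hk : Selc_le X k !=set0)
    (hp1 : p <> 1%N)
    (hpk : (p <= k)%N)
    (hmk : m%:R / 2 <= k%:R :> rat)
    (hpm : (p %| m)%N) :
  Selc X m !=set0.
Proof.
have le_mk : (m <= k.*2)%N.
  by move: hmk; rewrite ler_pdivrMr // -natrM ler_nat muln2.
case: m => [|m] in hmk hpm le_mk *.
  have noA (A : subsets_of_card X 0) : False.
    have [_ [a Aa]] := set_mem (valP (\val A)).
    have A0 : hset (\val A) #= `I_0 := set_mem (valP A).
    move: A0 Aa; rewrite II0 card_eq0.
    by rewrite -[\val (\val A)]/(hset (\val A)) => /eqP ->.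
  exists (fun A => False_rect X (noA A)).
  by split=> A; case: (noA A).
have p_gt1 : (1 < p)%N.
  by case: p hp1 hpm {hpk} => [|[|]] //; rewrite dvd0n.
apply: (@Selc_nonempty_of_prime_dvd X (pdiv p) k) => //.
- exact: pdiv_prime.
- by apply: leq_trans hpk; rewrite pdiv_leq // ltnW.
- exact: dvdn_trans (pdiv_dvd p) hpm.
Qed.
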